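(* Consider the interval-based inference attack for the linear system described in the context. For every $k\ge 1$, let $$\Delta\mathcal{X}_{k-1|k}=\mathcal{X}_{k-1|k-1}\setminus\mathcal{X}_{k-1|k},\qquad \Delta\mathcal{Y}_{k-1|k}=\mathcal{Y}_{k-1|k-1}\setminus\mathcal{Y}_{k-1|k},\qquad \Delta\mathcal{Y}_{k|k}=\mathcal{Y}_{k|k-1}\setminus\mathcal{Y}_{k|k},$$ where $\setminus$ is the componentwise difference of endpoint vectors. Then the amount of uncertainty reduction at time $k$ is $$\overline{\mathrm{Vol}}(\Delta\mathcal{Y}_{k|k})=\left\|\Psi(A_3)\,\Delta\mathcal{X}_{k-1|k}\oplus\Psi(A_4)\,\Delta\mathcal{Y}_{k-1|k}\right\|_1,$$ and it satisfies the bounds $$\overline{\mathrm{Vol}}(\Delta\mathcal{Y}_{k|k})\ \ge\ 2\left\|c^y_{k|k}-c^y_{k|k-1}\right\|_1,$$ $$\overline{\mathrm{Vol}}(\Delta\mathcal{Y}_{k|k})\ \le\ \|A_3\|_1\,\overline{\mathrm{Vol}}(\Delta\mathcal{X}_{k-1|k})+\|A_4\|_1\,\overline{\mathrm{Vol}}(\Delta\mathcal{Y}_{k-1|k}),$$ where $c^y_{k|k}$ and $c^y_{k|k-1}$ are the centers of the intervals $\mathcal{Y}_{k|k}$ and $\mathcal{Y}_{k|k-1}$.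
   Context: System: $X_k=A_1X_{k-1}+A_2Y_{k-1}+B_1W^x_k$, $Y_k=A_3X_{k-1}+A_4Y_{k-1}+B_2W^y_k$, with public state $X_k\in\mathbb{R}^{n_x}$, private state $Y_k\in\mathbb{R}^{n_x}$, real matrices of compatible sizes, $A_1,A_2$ invertible. The disturbances satisfy $W^x_k\in\mathcal{W}^x_k$, $W^y_k\in\mathcal{W}^y_k$ and the initial states satisfy $X_0\in\mathcal{X}_{0|-1}$, $Y_0\in\mathcal{Y}_{0|-1}$, where all these sets are bounded intervals (boxes). At each time $k$ the adversary receives an interval observation set $\mathcal{M}^x_{k|k}$ containing the true public state $x_k$, with, for $k\ge1$, $\mathcal{M}^x_{k|k}\subseteq\mathcal{X}_{k|k-1}=\Psi(A_1)\mathcal{X}_{k-1|k-1}\oplus\Psi(A_2)\mathcal{Y}_{k-1|k-1}\oplus\Psi(B_1)\mathcal{W}^x_k$. Interval conventions: an interval $\mathcal{Z}=\{Z:\underline{Z}\le Z\le\overline{Z}\}\subset\mathbb{R}^n$ (componentwise) is identified with the stacked endpoint vector $[\underline{Z}^\top,\overline{Z}^\top]^\top\in\mathbb{R}^{2n}$; its center is $(\overline{Z}+\underline{Z})/2$ and its radius is $(\overline{Z}-\underline{Z})/2$. A $2m\times 2n$ matrix acts on an interval by multiplying the endpoint vector. $\mathcal{X}\oplus\mathcal{Y}$ and $\mathcal{X}\setminus\mathcal{Y}$ denote, respectively, the sum and difference of endpoint vectors, so $\mathcal{X}\setminus\mathcal{Y}=[(\underline{X}-\underline{Y})^\top,(\overline{X}-\overline{Y})^\top]^\top$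 (it is not the set difference). Intersection: $\mathcal{X}\cap\mathcal{Y}=[\max\{\underline{X},\underline{Y}\}^\top,\min\{\overline{X},\overline{Y}\}^\top]^\top$ (componentwise max/min). The surrogate volume is $\overline{\mathrm{Vol}}(\mathcal{Z})=\sum_{i=1}^{n}(\overline{Z}(i)-\underline{Z}(i))$. For a matrix $A=[a_{ij}]$, $|A|=[|a_{ij}|]$, $\|A\|_1=\sum_{i,j}|a_{ij}|$; for a vector $b$, $\|b\|_1=\sum_i|b(i)|$. Define $$\Psi(A)=\begin{bmatrix}\frac{A+|A|}{2}&\frac{A-|A|}{2}\\ \frac{A-|A|}{2}&\frac{A+|A|}{2}\end{bmatrix}.$$ Interval-based inference attack: $\mathcal{Y}_{0|0}=\mathcal{Y}_{0|-1}$, $\mathcal{X}_{0|0}=\mathcal{M}^x_{0|0}\cap\mathcal{X}_{0|-1}$, and for $k\ge1$: $\mathcal{M}^x_{k-1|k}=\Psi(A_1^{-1})\mathcal{M}^x_{k|k}\oplus\Psi(-A_1^{-1}A_2)\mathcal{Y}_{k-1|k-1}\oplus\Psi(-A_1^{-1}B_1)\mathcal{W}^x_k$; $\mathcal{M}^y_{k-1|k}=\Psi(A_2^{-1})\mathcal{M}^x_{k|k}\oplus\Psi(-A_2^{-1}A_1)\mathcal{X}_{k-1|k-1}\oplus\Psi(-A_2^{-1}B_1)\mathcal{W}^x_k$; $\mathcal{X}_{k-1|k}=\mathcal{M}^x_{k-1|k}\cap\mathcal{X}_{k-1|k-1}$; $\mathcal{Y}_{k-1|k}=\mathcal{M}^y_{k-1|k}\cap\mathcal{Y}_{k-1|k-1}$;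 $\mathcal{M}^x_{k|k-1}=\Psi(A_1)\mathcal{X}_{k-1|k}\oplus\Psi(A_2)\mathcal{Y}_{k-1|k}\oplus\Psi(B_1)\mathcal{W}^x_k$; $\mathcal{X}_{k|k}=\mathcal{M}^x_{k|k}\cap\mathcal{M}^x_{k|k-1}$; $\mathcal{Y}_{k|k}=\Psi(A_3)\mathcal{X}_{k-1|k}\oplus\Psi(A_4)\mathcal{Y}_{k-1|k}\oplus\Psi(B_2)\mathcal{W}^y_k$; and the prior set is $\mathcal{Y}_{k|k-1}=\Psi(A_3)\mathcal{X}_{k-1|k-1}\oplus\Psi(A_4)\mathcal{Y}_{k-1|k-1}\oplus\Psi(B_2)\mathcal{W}^y_k$. *)

(* Defs.v *)
From HB Require Import structures.
From mathcomp Require Import all_boot all_order all_algebra.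
From mathcomp Require Import classical_sets reals.

Set Implicit Arguments.
Unset Strict Implicit.
Unset Printing Implicit Defensive.

Import Order.TTheory GRing.Theory Num.Theory.
Local Open Scope classical_set_scope.
Local Open Scope ring_scope.

(* An interval of R^n is its stacked endpoint vector (lower endpoint on top).
   No order between the endpoints is imposed, because the same type also holds
   differences of endpoint vectors.  The sum and the difference of intervals
   are the vector operations + and -, and a 2m x 2n matrix acts by *m. *)
Definition interval_vec (R : realType) (n : nat) := 'cV[R]_(n + n).

Definition lower (R : realType) n (Z : interval_vec R n) : 'cV[R]_n := usubmx Z.
Definition upper (R : realType) n (Z : interval_vec R n) : 'cV[R]_n := dsubmx Z.

Definition box (R : realType) n (Z : interval_vec R n) : set 'cV[R]_n :=
  [set z | forall i, lower Z i 0 <= z i 0 <= upper Z i 0].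

Definition center (R : realType) n (Z : interval_vec R n) : 'cV[R]_n :=
  2^-1 *: (upper Z + lower Z).

Definition interval_cap (R : realType) n (X Y : interval_vec R n) :
    interval_vec R n :=
  col_mx (map2_mx Num.max (lower X) (lower Y))
         (map2_mx Num.min (upper X) (upper Y)).

Definition Vol (R : realType) n (Z : interval_vec R n) : R :=
  \sum_(i < n) (upper Z i 0 - lower Z i 0).

Definition absmx (R : realType) m n (A : 'M[R]_(m, n)) : 'M[R]_(m, n) :=
  map_mx Num.norm A.

(* Entrywise, not the operator norm; on column vectors it is the l1 norm. *)
Definition norm1 (R : realType) m n (A : 'M[R]_(m, n)) : R :=
  \sum_(i < m) \sum_(j < n) `|A i j|.

Definition Psi (R : realType) m n (A : 'M[R]_(m, n)) :
    'M[R]_(m + m, n + n) :=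
  block_mx (2^-1 *: (A + absmx A)) (2^-1 *: (A - absmx A))
           (2^-1 *: (A - absmx A)) (2^-1 *: (A + absmx A)).

(* X_k = A1 X_{k-1} + A2 Y_{k-1} + B1 Wx_k,
   Y_k = A3 X_{k-1} + A4 Y_{k-1} + B2 Wy_k. *)
Record system (R : realType) (n p q : nat) := System {
  A1 : 'M[R]_n; A2 : 'M[R]_n; A3 : 'M[R]_n; A4 : 'M[R]_n;
  B1 : 'M[R]_(n, p); B2 : 'M[R]_(n, q) }.

(* setWx and setWy are used at times k >= 1 only; obs k is M^x_{k|k}. *)
Record attack_data (R : realType) (n p q : nat) := AttackData {
  initX : interval_vec R n;
  initY : interval_vec R n;
  setWx : nat -> interval_vec R p;
  setWy : nat -> interval_vec R q;
  obs   : nat -> interval_vec R n }.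

(* One-step maps at time k >= 1; X and Y are sets for the states at time k-1. *)

Definition propagateX (R : realType) n p q (S : system R n p q)
    (D : attack_data R n p q) (k : nat) (X Y : interval_vec R n) :
    interval_vec R n :=
  Psi (A1 S) *m X + Psi (A2 S) *m Y + Psi (B1 S) *m setWx D k.

Definition propagateY (R : realType) n p q (S : system R n p q)
    (D : attack_data R n p q) (k : nat) (X Y : interval_vec R n) :
    interval_vec R n :=
  Psi (A3 S) *m X + Psi (A4 S) *m Y + Psi (B2 S) *m setWy D k.

(* M^x_{k-1|k} *)
Definition backMx (R : realType) n p q (S : system R n p q)
    (D : attack_data R n p q) (k : nat) (Y : interval_vec R n) :
    interval_vec R n :=
  Psi (invmx (A1 S)) *m obs D k
  + Psi (- (invmx (A1 S) *m A2 S)) *m Y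
  + Psi (- (invmx (A1 S) *m B1 S)) *m setWx D k.

(* M^y_{k-1|k} *)
Definition backMy (R : realType) n p q (S : system R n p q)
    (D : attack_data R n p q) (k : nat) (X : interval_vec R n) :
    interval_vec R n :=
  Psi (invmx (A2 S)) *m obs D k
  + Psi (- (invmx (A2 S) *m A1 S)) *m X
  + Psi (- (invmx (A2 S) *m B1 S)) *m setWx D k.

Definition smoothX (R : realType) n p q (S : system R n p q)
    (D : attack_data R n p q) (k : nat) (X Y : interval_vec R n) :
    interval_vec R n :=
  interval_cap (backMx S D k Y) X.

Definition smoothY (R : realType) n p q (S : system R n p q)
    (D : attack_data R n p q) (k : nat) (X Y : interval_vec R n) :
    interval_vec R n :=
  interval_cap (backMy S D k X) Y.

(* The pair (X_{k|k}, Y_{k|k}). *)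
Fixpoint attack (R : realType) n p q (S : system R n p q)
    (D : attack_data R n p q) (k : nat) :
    interval_vec R n * interval_vec R n :=
  if k is k'.+1 then
    let X := (attack S D k').1 in
    let Y := (attack S D k').2 in
    let Xs := smoothX S D k X Y in
    let Ys := smoothY S D k X Y in
    (interval_cap (obs D k) (propagateX S D k Xs Ys),
     propagateY S D k Xs Ys)
  else (interval_cap (obs D 0) (initX D), initY D).

(* X_{k|k} and Y_{k|k} *)
Definition X_post (R : realType) n p q (S : system R n p q)
    (D : attack_data R n p q) (k : nat) := (attack S D k).1.
Definition Y_post (R : realType) n p q (S : system R n p q)
    (D : attack_data R n p q) (k : nat) := (attack S D k).2.

(* X_{k-1|k} and Y_{k-1|k}, for k >= 1 *)
Definition X_smooth (R : realType) n p q (S : system R n p q)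
    (D : attack_data R n p q) (k : nat) :=
  smoothX S D k (X_post S D k.-1) (Y_post S D k.-1).
Definition Y_smooth (R : realType) n p q (S : system R n p q)
    (D : attack_data R n p q) (k : nat) :=
  smoothY S D k (X_post S D k.-1) (Y_post S D k.-1).

(* X_{k|k-1} and Y_{k|k-1}, for k >= 1; the time-0 priors are initX, initY. *)
Definition X_prior (R : realType) n p q (S : system R n p q)
    (D : attack_data R n p q) (k : nat) :=
  propagateX S D k (X_post S D k.-1) (Y_post S D k.-1).
Definition Y_prior (R : realType) n p q (S : system R n p q)
    (D : attack_data R n p q) (k : nat) :=
  propagateY S D k (X_post S D k.-1) (Y_post S D k.-1).

(* Delta X_{k-1|k}, Delta Y_{k-1|k} and Delta Y_{k|k} *)
Definition dX_smooth (R : realType) n p q (S : system R n p q)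
    (D : attack_data R n p q) (k : nat) : interval_vec R n :=
  X_post S D k.-1 - X_smooth S D k.
Definition dY_smooth (R : realType) n p q (S : system R n p q)
    (D : attack_data R n p q) (k : nat) : interval_vec R n :=
  Y_post S D k.-1 - Y_smooth S D k.
Definition dY_post (R : realType) n p q (S : system R n p q)
    (D : attack_data R n p q) (k : nat) : interval_vec R n :=
  Y_prior S D k - Y_post S D k.

(* Main.v *)
(* Intersecting a set with its prior can only raise lower endpoints and lower
   upper endpoints, so every difference of endpoint vectors taken here has
   nonpositive lower and nonnegative upper part: as a box, it contains 0.  This
   property is stable under Psi(A) and under sums, the updates of Y are affine
   in the interval arguments, and on boxes containing 0 the surrogate volume is
   the l1 norm of the endpoint vector. *)
Require Import Defs.
From HB Require Import structures.
From mathcomp Require Import all_boot all_order all_algebra.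
From mathcomp Require Import classical_sets reals.
From mathcomp Require Import ring lra.

Set Implicit Arguments.
Unset Strict Implicit.
Unset Printing Implicit Defensive.

Import Order.TTheory GRing.Theory Num.Theory.
Local Open Scope classical_set_scope.
Local Open Scope ring_scope.

Lemma lowerD (R : realType) n (X Y : interval_vec R n) i :
  lower (X + Y) i 0 = lower X i 0 + lower Y i 0.
Proof. by rewrite !mxE. Qed.

Lemma upperD (R : realType) n (X Y : interval_vec R n) i :
  upper (X + Y) i 0 = upper X i 0 + upper Y i 0.
Proof. by rewrite !mxE. Qed.

Lemma lower_Psi (R : realType) m n (A : 'M[R]_(m, n)) (Z : interval_vec R n) i :
  lower (Psi A *m Z) i 0 =
  \sum_j (2^-1 * (A i j + `|A i j|) * lower Z j 0 +
          2^-1 * (A i j - `|A i j|) * upper Z j 0).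
Proof.
rewrite /lower /upper /Psi -{1}[Z]vsubmxK mul_block_col col_mxKu !mxE -big_split /=.
by apply: eq_bigr => j _; rewrite !mxE.
Qed.

Lemma upper_Psi (R : realType) m n (A : 'M[R]_(m, n)) (Z : interval_vec R n) i :
  upper (Psi A *m Z) i 0 =
  \sum_j (2^-1 * (A i j - `|A i j|) * lower Z j 0 +
          2^-1 * (A i j + `|A i j|) * upper Z j 0).
Proof.
rewrite /lower /upper /Psi -{1}[Z]vsubmxK mul_block_col col_mxKd !mxE -big_split /=.
by apply: eq_bigr => j _; rewrite !mxE.
Qed.

(** The diagonal and off-diagonal blocks of [Psi A] differ by [absmx A], so [absmx A] maps the
    widths of [Z] to those of the image. *)
Lemma Vol_Psi (R : realType) m n (A : 'M[R]_(m, n)) (Z : interval_vec R n) :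
  Vol (Psi A *m Z) =
  \sum_i \sum_j `|A i j| * (upper Z j 0 - lower Z j 0).
Proof.
apply: eq_bigr => i _; rewrite lower_Psi upper_Psi -sumrB.
by apply: eq_bigr => j _; field.
Qed.

Lemma VolD (R : realType) n (X Y : interval_vec R n) :
  Vol (X + Y) = Vol X + Vol Y.
Proof.
by rewrite /Vol -big_split /=; apply: eq_bigr => i _; rewrite lowerD upperD; ring.
Qed.

Lemma box0P (R : realType) n (Z : interval_vec R n) :
  box Z 0 <-> forall i, lower Z i 0 <= 0 /\ 0 <= upper Z i 0.
Proof.
split=> Z0 i; first by move: (Z0 i); rewrite [X in _ <= X <= _]mxE => /andP.
by rewrite [X in _ <= X <= _]mxE; apply/andP.
Qed.

(** Only [max] and [min] being bounds for [Z] matters, so this holds even if the intersection is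
    empty. *)
Lemma box0_subr_cap (R : realType) n (M Z : interval_vec R n) :
  box (Z - interval_cap M Z) 0.
Proof.
apply/box0P => i; rewrite /interval_cap /lower /upper; split.
  by rewrite linearB /= col_mxKu !mxE subr_le0 le_max lexx orbT.
by rewrite linearB /= col_mxKd !mxE subr_ge0 ge_min lexx orbT.
Qed.

Lemma box0D (R : realType) n (X Y : interval_vec R n) :
  box X 0 -> box Y 0 -> box (X + Y) 0.
Proof.
move=> /box0P X0 /box0P Y0; apply/box0P => i; rewrite lowerD upperD.
by have [? ?] := X0 i; have [? ?] := Y0 i; split; lra.
Qed.

Lemma box0_Psi (R : realType) m n (A : 'M[R]_(m, n)) (Z : interval_vec R n) :
  box Z 0 -> box (Psi A *m Z) 0.
Proof.
move=> /box0P Z0; apply/box0P => i; rewrite lower_Psi upper_Psi.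
split; [apply: sumr_le0 | apply: sumr_ge0] => j _; have [l0 u0] := Z0 j;
  (* These two inequalities make the entries of the diagonal blocks nonnegative and those of the
     off-diagonal blocks nonpositive, which fixes the sign of each product. *)
  have := ler_norm (A i j); have := ler_norm (- A i j); rewrite normrN; nra.
Qed.

Lemma Vol_norm1 (R : realType) n (Z : interval_vec R n) :
  box Z 0 -> Vol Z = norm1 Z.
Proof.
move=> /box0P Z0; rewrite /Vol /norm1 big_split_ord /= -big_split /=.
apply: eq_bigr => i _; rewrite !big_ord1.
have [] := Z0 i; rewrite !mxE => l0 u0.
by rewrite (ler0_norm l0) (ger0_norm u0) addrC.
Qed.

(** In each coordinate, [l <= 0 <= u] gives [|u + l| <= u - l]. *)
Lemma norm1_center_le_Vol (R : realType) n (Z : interval_vec R n) :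
  box Z 0 -> 2 * norm1 (center Z) <= Vol Z.
Proof.
move=> /box0P Z0; rewrite /norm1 mulr_sumr; apply: ler_sum => i _.
have [l0 u0] := Z0 i; rewrite big_ord1.
have -> : center Z i 0 = 2^-1 * (upper Z i 0 + lower Z i 0) by rewrite !mxE.
rewrite normrM gtr0_norm ?invr_gt0 // mulVKf ?pnatr_eq0 // ler_norml; lra.
Qed.

Lemma norm1_centerB (R : realType) n (X Y : interval_vec R n) :
  norm1 (center X - center Y) = norm1 (center (Y - X)).
Proof.
apply: eq_bigr => i _; apply: eq_bigr => j _; rewrite -normrN.
by congr (`|_|); rewrite !mxE; ring.
Qed.

(** The widths of [Z] are nonnegative, so each one is at most their sum [Vol Z]; this replaces every
    width in [Vol_Psi]. *)
Lemma Vol_Psi_le (R : realType) m n (A : 'M[R]_(m, n)) (Z : interval_vec R n) :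
  box Z 0 -> Vol (Psi A *m Z) <= norm1 A * Vol Z.
Proof.
move=> /box0P Z0; have w0 j : 0 <= upper Z j 0 - lower Z j 0.
  by have [? ?] := Z0 j; lra.
rewrite Vol_Psi mulr_suml; apply: ler_sum => i _.
rewrite mulr_suml; apply: ler_sum => j _; apply: ler_wpM2l => //.
by rewrite /Vol (bigD1 j) //= lerDl sumr_ge0.
Qed.

(** Prior and posterior come from the same affine map with the same disturbance set, whose term
    cancels. *)
Lemma dY_postE (R : realType) n p q (S : system R n p q)
    (D : attack_data R n p q) k : (1 <= k)%N ->
  dY_post S D k = Psi (A3 S) *m dX_smooth S D k + Psi (A4 S) *m dY_smooth S D k.
Proof.
case: k => // k _; rewrite /dX_smooth /dY_smooth !mulmxBr.
have YE : Y_post S D k.+1 =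
    propagateY S D k.+1 (X_smooth S D k.+1) (Y_smooth S D k.+1) by [].
by rewrite /dY_post YE /Y_prior /propagateY opprD addrACA subrr addr0 opprD addrACA.
Qed.

Theorem theorem9 (R : realType) (n p q : nat)
    (S : system R n p q) (D : attack_data R n p q)
    (x y : nat -> 'cV[R]_n) (wx : nat -> 'cV[R]_p) (wy : nat -> 'cV[R]_q)
    (A1_inv : A1 S \in unitmx) (A2_inv : A2 S \in unitmx)
    (x_dyn : forall k, (1 <= k)%N ->
       x k = A1 S *m x k.-1 + A2 S *m y k.-1 + B1 S *m wx k)
    (y_dyn : forall k, (1 <= k)%N ->
       y k = A3 S *m x k.-1 + A4 S *m y k.-1 + B2 S *m wy k)
    (x_init : box (initX D) (x 0%N)) (y_init : box (initY D) (y 0%N))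
    (wx_in : forall k, (1 <= k)%N -> box (setWx D k) (wx k))
    (wy_in : forall k, (1 <= k)%N -> box (setWy D k) (wy k))
    (x_obs : forall k, box (obs D k) (x k))
    (obs_sub : forall k, (1 <= k)%N -> box (obs D k) `<=` box (X_prior S D k)) :
  forall k, (1 <= k)%N ->
    [/\ Vol (dY_post S D k) =
          norm1 (Psi (A3 S) *m dX_smooth S D k + Psi (A4 S) *m dY_smooth S D k),
        Vol (dY_post S D k) >=
          2 * norm1 (center (Y_post S D k) - center (Y_prior S D k)) &
        Vol (dY_post S D k) <=
          norm1 (A3 S) * Vol (dX_smooth S D k)
          + norm1 (A4 S) * Vol (dY_smooth S D k)].
Proof.
move=> k k_gt0.
(* By conversion, both smoothing differences have the form [Z - interval_cap M Z], with [Z] the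
   posterior at [k.-1]. *)
have dX0 : box (dX_smooth S D k) 0 by exact: box0_subr_cap.
have dY0 : box (dY_smooth S D k) 0 by exact: box0_subr_cap.
have dYE := dY_postE S D k_gt0.
have dYpost0 : box (dY_post S D k) 0.
  by rewrite dYE; apply: box0D; exact: box0_Psi.
split.
- by rewrite -dYE Vol_norm1.
- by rewrite norm1_centerB norm1_center_le_Vol.
- by rewrite dYE VolD lerD ?Vol_Psi_le.
Qed.
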